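(* Consider problem (P) of the context. Let $(x_*(\cdot),u_*(\cdot))\in\mathscr{A}_{adm}\cap\mathscr{A}_{Lip}$. Suppose there are a locally absolutely continuous function $p(\cdot):\mathbb{R}_+\to\mathbb{R}^n$ and vectors $l_0,l_1\in\mathbb{R}^n$ with $l_1^i=0$ for every index $i$ whose endpoint is free, such that the conditions of the Pontryagin maximum principle hold in normal form: for almost all $t\in\mathbb{R}_+$ $$\dot p(t)=-\varphi_x^T(t,x_*(t),u_*(t))p(t)+\omega(t)f_x(t,x_*(t),u_*(t)),$$ $$p(0)=l_0,\qquad\lim_{t\to\infty}p(t)=-l_1,$$ and for almost all $t\in\mathbb{R}_+$ $$H(t,x_*(t),u_*(t),p(t),1)=\max_{u\in U}H(t,x_*(t),u,p(t),1).$$ Suppose in addition that for some $\gamma>0$ the Hamiltonian is concave in $x$ on $V_\gamma$, i.e. for every $t$ the function $x\mapsto\mathscr{H}(t,x,p(t))$ is concave on $\{x\in\mathbb{R}^n\mid\|x-x_*(t)\|\le\gamma\}$. Then $(x_*(\cdot),u_*(\cdot))$ is a strong local minimizer in problem (P).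
   Context: Notation: $\mathbb{R}_+=[0,\infty)$, $\overline{\mathbb{R}}_+=[0,\infty]$. $W^1_\infty(\mathbb{R}_+,\mathbb{R}^n)$ is the space of bounded, locally absolutely continuous functions with essentially bounded derivative; $L_\infty(\mathbb{R}_+,U)$ is the set of essentially bounded measurable functions with values in $U$. Data: $\omega\in L_1(\mathbb{R}_+,\mathbb{R})$, $\|\omega\|_{L_1}>0$; $f:\mathbb{R}\times\mathbb{R}^n\times\mathbb{R}^m\to\mathbb{R}$, $\varphi:\mathbb{R}\times\mathbb{R}^n\times\mathbb{R}^m\to\mathbb{R}^n$; $\emptyset\ne U\subseteq\mathbb{R}^m$; $x_0\in\mathbb{R}^n$. Problem (P): minimize $J(x,u)=\int_0^\infty\omega(t)f(t,x(t),u(t))\,dt$ subject to $\dot x(t)=\varphi(t,x(t),u(t))$ (Carathéodory sense on bounded intervals), $x(0)=x_0$, $\lim_{t\to\infty}x(t)=x_1$, $u(t)\in U$. Here ''$\lim_{t\to\infty}x(t)=x_1$'' denotes a mixed endpoint condition: for some $k\in\{0,\dots,n\}$, $\lim_{t\to\infty}x^i(t)$ is free (no condition) for $i=1,\dots,k$, and $\lim_{t\to\infty}x^i(t)=x_1^i$ with fixed numbers $x_1^i$ for $i=k+1,\dots,n$. $\mathscr{A}_{adm}$ (admissible processes): all $(x,u)\in W^1_\infty(\mathbb{R}_+,\mathbb{R}^n)\times L_\infty(\mathbb{R}_+,U)$ satisfying all constraints of (P) and making the Lebesgue integral $J$ finite. $\mathscr{A}_{Lip}$: all $(x,u)\in W^1_\infty\times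 L_\infty(\mathbb{R}_+,U)$ such that for every compact $U_1\subset\mathbb{R}^m$ there is $\gamma>0$ such that $f,\varphi$ are uniformly continuous in all variables and uniformly continuously differentiable in $x$ on $V_\gamma\times U_1$, where $V_\gamma=\{(t,y)\in\overline{\mathbb{R}}_+\times\mathbb{R}^n\mid\|y-x(t)\|\le\gamma\}$ (values at $t=\infty$ are limits as $t\to\infty$, whose existence is included). Strong local minimizer: admissible $(x_*,u_* )$ such that for some $\varepsilon>0$, $J(x,u)\ge J(x_*,u_* )$ for all $(x,u)\in\mathscr{A}_{adm}$ with $\|x-x_*\|_\infty\le\varepsilon$. Pontryagin function: $H(t,x,u,p,\lambda_0)=-\lambda_0\omega(t)f(t,x,u)+\langle p,\varphi(t,x,u)\rangle$. Hamiltonian: $\mathscr{H}(t,x,p)=\sup_{u\in U}H(t,x,u,p,1)$. *)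

(* Defs.v *)
From HB Require Import structures.
From mathcomp Require Import all_boot all_order all_algebra.
From mathcomp Require Import all_classical all_reals all_analysis.

Set Implicit Arguments.
Unset Strict Implicit.
Unset Printing Implicit Defensive.

Import Order.TTheory GRing.Theory Num.Theory.
Import numFieldNormedType.Exports.

Local Open Scope classical_set_scope.
Local Open Scope ring_scope.

(* Elements of R^n are row vectors and `|_| is the maximum norm on 'rV[R]_n.
   Norms are only compared with constants that are quantified existentially
   (or with all epsilons), so every norm of R^n gives equivalent notions.
   A function on R_+ = [0, +oo[ is represented by a function on R; its values
   at t < 0 play no role. *)

(* [lebesgue_measure] lives on the Borel sets, [completed_lebesgue_measure] on
   all Lebesgue measurable sets: the latter is needed because no measurability
   is assumed of the integrand f or of the dynamics phi. *)
Definition LebesgueR (R : realType) : measurableType _ :=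
  caratheodory_type (((wlength (@idfun R))^*)%mu).

Definition leb (R : realType) : {measure set (LebesgueR R) -> \bar R} :=
  @completed_lebesgue_measure R.

Definition Rplus (R : realType) : set (LebesgueR R) := `[0%R, +oo[%classic.

Definition ae_Rplus (R : realType) (Q : R -> Prop) : Prop :=
  {ae leb R, forall t : R, 0 <= t -> Q t}.

Definition integrable_Rplus (R : realType) (g : R -> R) : Prop :=
  (leb R).-integrable (@Rplus R) (fun t => (g t)%:E).

Definition integral_Rplus (R : realType) (g : R -> R) : R :=
  \int[leb R]_(t in @Rplus R) g t.

Definition dot (R : realType) (n : nat) (v w : 'rV[R]_n) : R :=
  \sum_(i < n) v 0 i * w 0 i.

Section function_spaces.
Context (R : realType).

Definition abs_continuous_on (n : nat) (a b : R) (x : R -> 'rV[R]_n) : Prop :=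
  forall e : R, 0 < e -> exists2 d : R, 0 < d &
    forall (N : nat) (s t : 'I_N -> R),
      (forall i, a <= s i /\ s i <= t i /\ t i <= b) ->
      trivIset setT (fun i => `]s i, t i[%classic) ->
      \sum_(i < N) (t i - s i) < d ->
      \sum_(i < N) `|x (t i) - x (s i)| < e.

Definition loc_abs_continuous (n : nat) (x : R -> 'rV[R]_n) : Prop :=
  forall T : R, 0 <= T -> abs_continuous_on 0 T x.

Definition W1_infty (n : nat) (x : R -> 'rV[R]_n) : Prop :=
  [/\ loc_abs_continuous x,
      exists C : R, forall t : R, 0 <= t -> `|x t| <= C &
      exists C : R, ae_Rplus (fun t => derivable x t 1 /\ `|derive1 x t| <= C)].

Definition L_infty (m : nat) (U : set 'rV[R]_m) (u : R -> 'rV[R]_m) : Prop :=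
  [/\ forall j, measurable_fun (@Rplus R) (fun t : LebesgueR R => u t 0 j),
      exists C : R, ae_Rplus (fun t => `|u t| <= C) &
      forall t : R, 0 <= t -> U (u t)].

End function_spaces.

(* The components x^i with i < nfree are free at infinity; the components of
   [target] with index i < nfree are not used. *)
Record control_problem (R : realType) (n m : nat) := ControlProblem {
  omega : R -> R;
  cost : R -> 'rV[R]_n -> 'rV[R]_m -> R;
  dynamics : R -> 'rV[R]_n -> 'rV[R]_m -> 'rV[R]_n;
  controls : set 'rV[R]_m;
  initial : 'rV[R]_n;
  nfree : 'I_n.+1;
  target : 'rV[R]_n
}.

Section problem.
Context (R : realType) (n m : nat) (P : control_problem R n m).
Implicit Types (x p : R -> 'rV[R]_n) (u : R -> 'rV[R]_m).

Local Notation f := (cost P).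
Local Notation phi := (dynamics P).
Local Notation U := (controls P).

Definition cost_integrand x u (t : R) : R := omega P t * f t (x t) (u t).

Definition J x u : R := integral_Rplus (cost_integrand x u).

Definition admissible x u : Prop :=
  W1_infty x /\ L_infty U u /\
  [/\ ae_Rplus (fun t => is_derive t 1 x (phi t (x t) (u t))),
      x 0 = initial P,
      forall i : 'I_n, (nfree P <= i)%N -> x t 0 i @[t --> +oo] --> target P 0 i &
      integrable_Rplus (cost_integrand x u)].

Definition strong_local_minimizer x u : Prop :=
  admissible x u /\
  exists2 e : R, 0 < e &
    forall y v, admissible y v ->
      (forall t : R, 0 <= t -> `|y t - x t| <= e) -> J x u <= J y v.

Definition f_x (t : R) (y : 'rV[R]_n) (v : 'rV[R]_m) : 'rV[R]_n :=
  \row_i 'D_(delta_mx 0 i) (fun z => f t z v) y.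

(* Since vectors are rows, ['J] is the transpose of the usual Jacobian matrix:
   [(phi_x t y v) i j] is the derivative of the i-th component in direction j. *)
Definition phi_x (t : R) (y : 'rV[R]_n) (v : 'rV[R]_m) : 'M[R]_n :=
  ('J (fun z => phi t z v) y)^T.

(* Extension of g to the time t = +oo by its limit (junk at -oo). *)
Definition at_infty (V : normedModType R) (g : R -> V) (t : \bar R) : V :=
  if t is r%:E then g r else lim (g r @[r --> +oo]).

Definition tube x (gamma : R) : set (\bar R * 'rV[R]_n) :=
  [set z | (0 <= z.1)%E /\ `|z.2 - at_infty x z.1| <= gamma].

(* Uniform continuity refers to the uniform structure of the compact extended
   line \bar R in the time variable. *)
Definition unif_continuous_tube (V : normedModType R) x (gamma : R)
    (U1 : set 'rV[R]_m) (g : R -> 'rV[R]_n -> 'rV[R]_m -> V) : Prop :=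
  let A : set (\bar R * 'rV[R]_n * 'rV[R]_m) :=
    [set q | tube x gamma q.1 /\ U1 q.2] in
  (forall y v, tube x gamma (+oo%E, y) -> U1 v ->
     cvg (g t y v @[t --> +oo])) /\
  unif_continuous
    ((fun q => at_infty (fun t => g t q.1.2 q.2) q.1.1) : subspace A -> V).

Definition A_Lip x u : Prop :=
  W1_infty x /\ L_infty U u /\ cvg (x t @[t --> +oo]) /\
  forall U1 : set 'rV[R]_m, compact U1 -> exists2 gamma : R, 0 < gamma &
    [/\ unif_continuous_tube x gamma U1 f,
        unif_continuous_tube x gamma U1 phi,
        forall t y v, tube x gamma (t%:E, y) -> U1 v ->
          differentiable (fun z => f t z v) y /\
          differentiable (fun z => phi t z v) y,
        unif_continuous_tube x gamma U1 f_x &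
        unif_continuous_tube x gamma U1 phi_x].

Definition pontryagin (t : R) (y : 'rV[R]_n) (v : 'rV[R]_m) (q : 'rV[R]_n)
    (lambda0 : R) : R :=
  - lambda0 * omega P t * f t y v + dot q (phi t y v).

(* The supremum may be +oo. *)
Definition hamiltonian (t : R) (y q : 'rV[R]_n) : \bar R :=
  ereal_sup [set (pontryagin t y v q 1)%:E | v in U].

End problem.

Definition is_max (R : realType) (A : set R) (a : R) : Prop := A a /\ ubound A a.

(* No indeterminate form occurs for functions that never take the value -oo,
   such as y |-> hamiltonian P t y q with a nonempty control set. *)
Definition concave_on (R : realType) (n : nat) (D : set 'rV[R]_n)
    (g : 'rV[R]_n -> \bar R) : Prop :=
  forall (y z : 'rV[R]_n) (s : R), D y -> D z -> 0 <= s <= 1 ->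
    (s%:E * g y + (1 - s)%:E * g z <= g (s *: y + (1 - s) *: z)%R)%E.

(* Main.v *)
(* Sufficiency by a support argument: at almost every t the function
   H(t, ., u_*(t), p(t)) lies below the concave Hamiltonian and touches it at
   x_*(t), so its differential there, which is - p'(t), is a supergradient of
   the Hamiltonian. For an admissible (x, u) in the tube this reads
   (d/dt) <p, x - x_*> <= omega (f(t, x, u) - f(t, x_*, u_* )) almost everywhere.
   The left-hand side is absolutely continuous, vanishes at 0, and tends to 0
   at infinity by transversality, so integration gives
   0 <= J(x, u) - J(x_*, u_* ). *)
Require Import Defs.
From HB Require Import structures.
From mathcomp Require Import all_boot all_order all_algebra.
From mathcomp Require Import all_classical all_reals all_analysis.
From mathcomp Require Import measurable_realfun ring lra.

Set Implicit Arguments.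
Unset Strict Implicit.
Unset Printing Implicit Defensive.

Import Order.TTheory GRing.Theory Num.Theory.
Import numFieldNormedType.Exports.

Local Open Scope classical_set_scope.
Local Open Scope ring_scope.

(** * Absolutely continuous functions and the sign of their derivative *)

Section absolute_continuity.
Context {R : realType}.
Local Notation mu := (@lebesgue_measure R).

(* Convertible to [abs_continuous_on] when [V] is a space of row vectors. *)
Definition abs_cont (V : normedModType R) (a b : R) (x : R -> V) : Prop :=
  forall e : R, 0 < e -> exists2 d : R, 0 < d &
    forall (N : nat) (s t : 'I_N -> R),
      (forall i, a <= s i /\ s i <= t i /\ t i <= b) ->
      trivIset setT (fun i => `]s i, t i[%classic) ->
      \sum_(i < N) (t i - s i) < d ->
      \sum_(i < N) `|x (t i) - x (s i)| < e.

(** Serves differences and dot products alike: increments of either are controlled by the increments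
    of the two functions combined. *)
Lemma abs_cont_dominated (V1 V2 W : normedModType R) (a b C : R)
    (x : R -> V1) (z : R -> V2) (F : R -> W) :
  0 <= C -> abs_cont a b x -> abs_cont a b z ->
  (forall s t, a <= s <= b -> a <= t <= b ->
    `|F t - F s| <= C * (`|x t - x s| + `|z t - z s|)) ->
  abs_cont a b F.
Proof.
move=> C0 xac zac FC e e0.
have C1 : 0 < C + 1 by lra.
(* [C + 1] instead of [C] keeps the divisor positive and the final bound strict when [C = 0]. *)
pose e' := e / (2 * (C + 1)).
have e'0 : 0 < e' by rewrite divr_gt0// mulr_gt0.
have [d1 d10 xd] := xac _ e'0; have [d2 d20 zd] := zac _ e'0.
exists (Num.min d1 d2) => [|N s t st tst]; first by rewrite lt_min d10.
rewrite lt_min => /andP[/xd - /(_ st tst) xl /zd - /(_ st tst) zl].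
have le1 : \sum_(i < N) `|F (t i) - F (s i)| <=
    C * (\sum_(i < N) `|x (t i) - x (s i)| + \sum_(i < N) `|z (t i) - z (s i)|).
  rewrite -big_split/= mulr_sumr; apply: ler_sum => i _.
  by have [? [? ?]] := st i; apply: FC; lra.
have le2 : C * (\sum_(i < N) `|x (t i) - x (s i)| +
    \sum_(i < N) `|z (t i) - z (s i)|) <= C * (e' + e').
  by rewrite ler_wpM2l// ltW// ltrD.
have -> : e = (C + 1) * (e' + e') by rewrite /e'; field; rewrite gt_eqF.
apply: (le_lt_trans le1); apply: (le_lt_trans le2).
by rewrite ltr_pM2r; lra.
Qed.

Lemma measure_disjoint_itvs (N : nat) (s t : 'I_N -> R) :
  (forall i, s i <= t i) -> trivIset setT (fun i => `]s i, t i[%classic) ->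
  mu (\big[setU/set0]_(i < N) `]s i, t i[%classic) =
  (\sum_(i < N) (t i - s i))%:E.
Proof.
move=> st tst; rewrite measure_semi_additive_ord//=; last first.
  by apply: bigsetU_measurable => i _; exact: measurable_itv.
rewrite -sumEFin; apply: eq_bigr => i _.
rewrite lebesgue_measure_itv/= lte_fin.
case: ltP => // ts; have -> : t i = s i by apply/eqP; rewrite eq_le ts st.
by rewrite subrr.
Qed.

Lemma EFin_Rintegral d (T : measurableType d) (nu : {measure set T -> \bar R})
    (D : set T) (f : T -> R) : measurable D -> nu.-integrable D (EFin \o f) ->
  (\int[nu]_(x in D) f x)%:E = (\int[nu]_(x in D) (f x)%:E)%E.
Proof. by move=> mD intf; rewrite fineK//; exact: integrable_fin_num. Qed.

(** Absolute continuity of the Lebesgue integral: [|h|] has small integral over every set of small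
    measure, here the union of the given intervals. *)
Lemma abs_cont_primitive (h : R -> R) (a b : R) :
  mu.-integrable setT (EFin \o h) ->
  abs_cont a b (fun x => \int[mu]_(t in `]-oo, x]) h t : R^o).
Proof.
move=> inth e e0; have [d [d0 hd]] := integral_normr_continuous inth e0.
exists d => // N s t st tst sum_lt.
pose A := \big[setU/set0]_(i < N) `]s i, t i[%classic.
have mA : measurable A by apply: bigsetU_measurable => i _; exact: measurable_itv.
have muA : (mu A < d%:E)%E.
  by rewrite measure_disjoint_itvs ?lte_fin// => i; have [_ []] := st i.
apply: le_lt_trans (hd _ mA muA).
have mh : measurable_fun setT h by case/integrableP : inth => /measurable_EFinP.
have intS (B : set R) : measurable B -> mu.-integrable B (EFin \o h).
  by move=> mB; exact: integrableS inth.
have int_norm (B : set R) : measurable B ->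
    mu.-integrable B (EFin \o (fun x => `|h x|)).
  by move=> mB; have := integrable_norm (intS B mB).
rewrite -lee_fin EFin_Rintegral ?int_norm// -sumEFin.
rewrite /A ge0_integral_bigsetU//=; first last.
- apply: measurable_funTS; apply/measurable_EFinP; exact: measurableT_comp.
- by move=> i j _ _; apply: tst.
- by rewrite index_enum_uniq.
apply: lee_sum => i _; have [_ [sti _]] := st i.
have mst : measurable `]s i, t i[%classic by exact: measurable_itv.
rewrite -EFin_Rintegral ?int_norm// lee_fin.
rewrite Rintegral_itvB ?bnd_simp//; last by apply: intS; exact: measurable_itv.
rewrite -Rintegral_itv_bndo_bndc; last by apply: intS; exact: measurable_itv.
by apply: le_normr_Rintegral => //; exact: intS.
Qed.

(** A straddle estimate: near [c] the difference quotients on both sides are below [e], and the two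
    increments add up. *)
Lemma derive1_le0_local (K : R -> R) (c e : R) : 0 < e ->
  derivable K c 1 -> derive1 K c <= 0 ->
  exists2 d, 0 < d & forall r s, r <= c -> c <= s -> c - d < r -> s < c + d ->
    K s - K r <= e * (s - r).
Proof.
move=> e0 dK K0.
have : h^-1 *: (K (h + c) - K c) @[h --> 0^'] --> (derive1 K c).
  have /= := dK; rewrite /derivable derive1E /derive => /cvgP.
  by under eq_fun do rewrite scaler1.
move=> /(@cvgr_lt _ R^o) - /(_ e (le_lt_trans K0 e0)).
move=> /nbhs_ballP[d /= d0 Hd]; exists d => // r s rc cs cr sc.
have up h : h != 0 -> `|h| < d -> h^-1 * (K (h + c) - K c) < e.
  by move=> h0 hd; apply: Hd => //; rewrite /ball/= sub0r normrN.
have sP : K s - K c <= e * (s - c).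
  have [->|sNc] := eqVneq s c; first by rewrite !subrr mulr0.
  have sc0 : 0 < s - c by rewrite subr_gt0 lt_neqAle eq_sym sNc.
  have := up (s - c) (lt0r_neq0 sc0).
  rewrite gtr0_norm// subrK => /(_ ltac:(lra)).
  by rewrite mulrC ltr_pdivrMr// => /ltW.
have rP : K c - K r <= e * (c - r).
  have [->|rNc] := eqVneq r c; first by rewrite !subrr mulr0.
  have rc0 : r - c < 0 by rewrite subr_lt0 lt_neqAle rNc.
  have := up (r - c) (ltr0_neq0 rc0).
  rewrite ltr0_norm// subrK => /(_ ltac:(lra)).
  by rewrite mulrC ltr_ndivrMr// => /ltW; lra.
lra.
Qed.

(* Exceptional points are absorbed by disjoint intervals inside an open set of
   small measure, over which absolute continuity controls the variation; a
   supremum argument then chains the local estimates along [a, b]. *)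
Lemma abs_cont_ae_derive_le0 (K : R -> R) (a b : R) (N : set R) : a <= b ->
  abs_cont a b (K : R -> R^o) -> mu.-negligible N ->
  (forall t, a <= t <= b -> ~ N t -> derivable K t 1 /\ derive1 K t <= 0) ->
  K b <= K a.
Proof.
move=> ab Kac /negligible_outer_measure N0 dK.
apply/ler_addgt0Pr => e e0.
have ba1 : 0 < b - a + 1 by lra.
(* Half of [e] pays for the slope [e1] along [[a, b]], the other half for the variation over the
   exceptional set. The [+ 1] covers [a = b]. *)
pose e1 := e / 2 / (b - a + 1).
have e10 : 0 < e1 by rewrite !divr_gt0.
have [d d0 Kd] := Kac _ (divr_gt0 e0 (ltr0Sn R 1)).
(* The cover is bounded non-strictly, whereas [Kd] asks for a total length strictly below [d]; hence
   [d / 2]. *)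
have [V [oV NV muV]] := @outer_measure_open_le R N (d / 2) ltac:(lra).
rewrite N0 add0e in muV.
(* The intervals are listed from left to right and indexed by [nat], so that a local step can append
   one at index [k]. *)
pose good c := (a <= c <= b) /\ exists (k : nat) (s t : nat -> R),
  [/\ forall i, (i < k)%N -> [/\ a <= s i, s i <= t i, t i <= c &
        `]s i, t i[%classic `<=` V],
      forall i j, (i < j < k)%N -> t i <= s j &
      K c - K a <= e1 * (c - a) + \sum_(i < k) `|K (t i) - K (s i)|].
have good_a : good a.
  split; first by rewrite lexx.
  by exists 0%N, (fun=> 0), (fun=> 0); split => //; rewrite big_ord0; lra.
have local_step c : a <= c <= b -> exists2 eta, 0 < eta & forall r s,
    r <= c -> c <= s -> c - eta < r -> s < c + eta -> s <= b -> good r -> good s.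
  move=> cab; have [Nc|Nc] := pselect (N c).
    have /nbhs_ballP[eta /= eta0 etaV] : nbhs c V.
      by apply: open_nbhs_nbhs; split => //; exact: NV.
    exists eta => // r s rc cs cr sc sb [rab [k [u [v [uv uv' Kr]]]]].
    have nk (i : nat) (ik : (i < k)%N) : (i == k) = false := ltn_eqF ik.
    split; first lra.
    exists k.+1, (fun i => if i == k then r else u i),
      (fun i => if i == k then s else v i).
    split.
    - move=> i; rewrite ltnS leq_eqVlt; case: eqVneq => [_ _|_ /= /uv[? ? ? ?]].
        split; try lra; move=> x /=; rewrite in_itv/= => rxs.
        by apply: etaV; rewrite /ball/= ltr_norml; lra.
      by split => //; lra.
    - move=> i j /andP[ij]; rewrite ltnS leq_eqVlt.
      have [ejk _|_ /= jk] := eqVneq j k.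
        by subst j; rewrite nk//; have [] := uv i ij.
      rewrite (nk i (ltn_trans ij jk)); apply: uv'; by rewrite ij jk.
    - rewrite big_ord_recr/= eqxx; under eq_bigr do rewrite nk//.
      have := ler_norm (K s - K r).
      have : e1 * (r - a) <= e1 * (s - a) by rewrite ler_pM2l//; lra.
      lra.
  have [dKc K'c] := dK _ cab Nc.
  have [eta eta0 Heta] := derive1_le0_local e10 dKc K'c.
  exists eta => // r s rc cs cr sc sb [rab [k [u [v [uv uv' Kr]]]]].
  split; first lra.
  exists k, u, v; split => //.
    by move=> i /uv[? ? ? ?]; split => //; lra.
  by have := Heta r s rc cs cr sc; lra.
have ubS : ubound good b by move=> c [/andP[]].
have hS : has_sup good by split; [exists a|exists b].
set c := sup good.
have ac : a <= c by apply: sup_upper_bound.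
have cb : c <= b by apply: ge_sup => //; exists a.
(* A good point within [eta] below the supremum is carried past it: either to [b], or to
   [c + eta / 2], which contradicts the supremum. *)
have good_b : good b.
  have [|eta eta0 step] := local_step c; first lra.
  have [r gr cr] := sup_adherent eta0 hS.
  have rc : r <= c by apply: sup_upper_bound.
  have [bc|bc] := leP b (c + eta / 2).
    by apply: step gr => //; lra.
  have /(sup_upper_bound hS) : good (c + eta / 2) by apply: step gr => //; lra.
  rewrite -/c; lra.
have [_ [k [s [t [st st' Kb]]]]] := good_b.
pose s' (i : 'I_k) := s i; pose t' (i : 'I_k) := t i.
have st_le i : a <= s' i /\ s' i <= t' i /\ t' i <= b by have [] := st i (ltn_ord i).
have tst : trivIset setT (fun i => `]s' i, t' i[%classic).
  apply/trivIsetP => i j _ _ ij; apply/seteqP; split => // x [] /=.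
  rewrite !in_itv/=; case: (ltngtP i j) => [lij|lji|/val_inj eij].
  - by have := st' i j; rewrite lij ltn_ord => /(_ isT); rewrite /s' /t'; lra.
  - by have := st' j i; rewrite lji ltn_ord => /(_ isT); rewrite /s' /t'; lra.
  - by rewrite eij eqxx in ij.
(* The intervals are disjoint and lie in [V], so their total length is at most its measure. *)
have len : \sum_(i < k) (t' i - s' i) < d.
  rewrite -lte_fin -measure_disjoint_itvs//; last first.
    by move=> i; have [_ []] := st_le i.
  apply: (@le_lt_trans _ _ (d / 2)%:E); last by rewrite lte_fin; lra.
  apply: le_trans muV; apply: le_measure; rewrite ?inE.
  - by apply: bigsetU_measurable => i _; exact: measurable_itv.
  - exact: open_measurable.
  - by rewrite -bigcup_seq; apply: bigcup_sub => i _; have [] := st i (ltn_ord i).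
have := Kd k s' t' st_le tst len.
have : e1 * (b - a) <= e / 2.
  by rewrite /e1 mulrAC ler_pdivrMr// ler_wpM2l//; lra.
rewrite /s' /t'; lra.
Qed.

End absolute_continuity.

(** * Passage from completed Lebesgue measure to its Borel restriction *)

Section completed_measure.
Context {R : realType}.
Local Notation mu := (@lebesgue_measure R).

(** Both measures come from one outer measure, and negligible means of outer measure zero for
    either. *)
Lemma leb_negligibleE (N : set R) : (leb R).-negligible N <-> mu.-negligible N.
Proof.
rewrite negligible_outer_measure; split => [[/= A [mA A0 NA]]|N0].
  by apply/eqP; rewrite eq_le outer_measure_ge0 andbT -A0 le_outer_measure.
have [/= A [mA A0 NA]] := (negligible_outer_measure N).2 N0.
by exists A; split => //; exact: sub_caratheodory.
Qed.

Lemma measurable_leb_borel (A : set (LebesgueR R)) : measurable A ->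
  exists B : set R,
    [/\ measurable B, B `<=` A & mu.-negligible (A `\` B)].
Proof.
have -> : measurable A =
    (completed_algebra_gen mu).-sigma.-measurable (A : set R).
  by rewrite completed_caratheodory_measurable.
rewrite g_sigma_completed_algebra_genE => -[B mB [N NN <-]].
exists B; split => //; apply: negligibleS NN.
by move=> x [[]].
Qed.

(** Each superlevel set at a rational threshold has a Borel core of full measure. Once [g] is set to
    0 on a Borel null set containing all the differences, its superlevel sets are built from
    countably many cores. *)
Lemma borel_version (g : LebesgueR R -> R) : measurable_fun setT g ->
  exists2 h : R -> R, measurable_fun setT h & mu.-negligible [set t | h t <> g t].
Proof.
move=> mg.
have mE (q : rat) : measurable [set t | ratr q < g t].
  rewrite [X in measurable X](_ : _ = setT `&` g @^-1` `]ratr q, +oo[%classic).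
    by apply: mg => //; exact: measurable_itv.
  by rewrite setTI; apply/seteqP; split => t /=; rewrite in_itv/= andbT.
have [B HB] := choice (fun q => measurable_leb_borel (mE q)).
(* The rationals are enumerated by [unpickle]; codes of no rational contribute the empty set. *)
have [N [mN N0 BN]] : mu.-negligible
    (\bigcup_(n in @setT nat) (if unpickle n is Some q then
       [set t | ratr q < g t] `\` B q else set0)).
  apply: negligible_bigcup => n; case: (unpickle n) => [q|].
  - by have [] := HB q.
  - exact: negligible_set0.
pose h t := if t \in N then 0 else g t.
exists h; last first.
  exists N; split => // t /=; rewrite /h; case: ifPn => [|_]; first by rewrite inE.
  by [].
move=> _; apply: (measurability _ (RGenOInfty.measurableE R)) => //.
move=> /= _ [_ [x ->] <-]; rewrite setTI.
(* Since [h] is 0 on [N], the set [N] lies in the superlevel set exactly when [x < 0]. *)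
rewrite [X in measurable X](_ : _ = (if x < 0 then N else set0) `|`
    \bigcup_(n in @setT nat) (if unpickle n is Some q then
       (if x < ratr q then B q `\` N else set0) else set0)).
  apply: measurableU; first by case: ifP.
  apply: bigcupT_measurable => n; case: (unpickle n) => [q|//].
  by case: ifP => // _; apply: measurableD => //; have [] := HB q.
apply/seteqP; split => t /=; rewrite in_itv/= andbT /h.
- case: ifPn => [|/negP tN xg]; first by rewrite inE => tN x0; left; rewrite x0.
  have [q] := rat_in_itvoo xg; rewrite in_itv/= => /andP[xq qg].
  right; exists (pickle q); [exact: I|]; rewrite pickleK xq.
  split; last by rewrite inE in tN.
  apply: contrapT => nB; apply: tN; rewrite inE; apply: BN.
  by exists (pickle q); [exact: I|]; rewrite pickleK.
- case => [|[n _]]; first by case: ifP => // x0 tN; rewrite mem_set.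
  case: (unpickle n) => [q|//]; case: ifP => // xq [Bt Nt].
  rewrite memNset//; have [_ BA _] := HB q.
  by apply: lt_trans xq _; exact: BA.
Qed.

Lemma measurable_fun_leb_id :
  measurable_fun [set: LebesgueR R] (idfun : LebesgueR R -> measurableTypeR R).
Proof. by move=> _ B mB; rewrite setTI; exact: sub_caratheodory. Qed.

(** [lebesgue_measure] is the pushforward of [leb] along the identity, so this is a change of
    variables. *)
Lemma integral_leb_borel (D : set R) (h : R -> R) : measurable D ->
  measurable_fun setT h -> (leb R).-integrable D (EFin \o h) ->
  mu.-integrable D (EFin \o h) /\
  \int[leb R]_(t in D) h t = \int[mu]_(t in D) h t.
Proof.
move=> mD mh inth.
have mEh : measurable_fun [set: measurableTypeR R] (EFin \o h).
  exact/measurable_EFinP.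
split.
  by have := @integrable_pushforward _ _ _ _ _ _ measurable_fun_leb_id
    (leb R) D _ mEh inth mD.
have := @integral_pushforward _ _ _ _ _ _ measurable_fun_leb_id
  (leb R) D _ mEh inth mD.
by move=> e; rewrite /Rintegral; congr fine; rewrite -e.
Qed.

End completed_measure.

(** * Integral bounds from almost everywhere derivative bounds, up to infinity *)

Section integral_bound.
Context {R : realType}.
Local Notation mu := (@lebesgue_measure R).

(** Subtracting the primitive [G] of [h] leaves an absolutely continuous function with nonpositive
    derivative outside [N] and the null set where [G] fails to have derivative [h]. *)
Lemma abs_cont_sub_le_integral (F h : R -> R) (a b : R) (N : set R) : a <= b ->
  abs_cont a b (F : R -> R^o) -> mu.-integrable setT (EFin \o h) ->
  mu.-negligible N ->
  (forall t, a <= t <= b -> ~ N t -> derivable F t 1 /\ derive1 F t <= h t) ->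
  F b - F a <= \int[mu]_(t in `]a, b]) h t.
Proof.
move=> ab Fac inth N0 dF.
pose G (x : R) := \int[mu]_(t in `]-oo, x]) h t.
have inth' (y : R) : mu.-integrable `]-oo, y] (EFin \o h).
  by apply: integrableS inth => //; exact: measurable_itv.
have loch : locally_integrable [set: R] h.
  by apply: open_integrable_locally => //; exact: openT.
have dG := FTC1Ny inth' loch.
have Gac : abs_cont a b (G : R -> R^o) := abs_cont_primitive a b inth.
have <- : G b - G a = \int[mu]_(t in `]a, b]) h t.
  by rewrite /G Rintegral_itvB ?bnd_simp.
suff : F b - G b <= F a - G a by lra.
apply: (@abs_cont_ae_derive_le0 _ (F \- G) a b
  (N `|` ~` [set x | derivable G x 1 /\ derive1 G x = h x])) => //.
- apply: (@abs_cont_dominated _ R^o R^o R^o a b 1 F G) => // s t _ _.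
  rewrite mul1r (_ : _ - _ = (F t - F s) - (G t - G s)); first exact: ler_normB.
  by rewrite /=; ring.
- exact: negligibleU.
- move=> t tab /not_orP[Nt /contrapT[dGt G't]].
  have [dFt F't] := dF t tab Nt.
  split; first exact: derivableB.
  by rewrite derive1E deriveB// -!derive1E G't subr_le0.
Qed.

Lemma cvg_integral_itv (h : R -> R) : mu.-integrable setT (EFin \o h) ->
  (\int[mu]_(t in `]0, n%:R]) h t)%R @[n --> \oo] -->
  (\int[mu]_(t in `]0%R, +oo[) h t)%R.
Proof.
move=> inth.
have mh : measurable_fun setT h by case/integrableP : inth => /measurable_EFinP.
have mitv (i : interval R) : measurable_fun setT (EFin \o (h \_ [set` i])).
  apply/measurable_EFinP; apply/(measurable_restrictT _ _).1 => //.
  exact: measurable_funTS.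
pose f_ (n : nat) := EFin \o (h \_ `]0, n%:R]).
have [] := @dominated_convergence _ _ _ mu setT measurableT f_
    (EFin \o (h \_ `]0, +oo[)) (EFin \o (fun x => `|h x|)).
- by move=> n; exact: mitv.
- exact: mitv.
(* Pointwise the sequence is eventually constant: [h t] once [n >= t] for positive [t], and 0
   otherwise. *)
- apply: aeW => t _.
  have [t0|t0] := ltP 0 t.
    apply: cvg_near_cst; near=> n; rewrite /f_ /= !patchE !mem_set//=.
      by rewrite in_itv/= t0.
    by rewrite in_itv/= t0/=; near: n; exact: nbhs_infty_ger.
  apply: cvg_near_cst; near=> n.
  by rewrite /f_ /= !patchE !memNset//= in_itv/= ltNge t0.
- exact: integrable_norm.
- apply: aeW => t n _; rewrite /f_ /= patchE; case: ifP => _; rewrite lee_fin//.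
  by rewrite normr0.
move=> _ _; rewrite /f_ => cvgE.
have intE (i : interval R) : (\int[mu]_t (EFin \o (h \_ [set` i])) t)%E =
    (\int[mu]_(t in [set` i]) h t)%:E.
  rewrite EFin_Rintegral//; last by apply: integrableS inth.
  by rewrite [RHS]integral_mkcond restrict_EFin.
move: cvgE; rewrite intE => /fine_cvg /=.
by under eq_fun do rewrite intE.
Unshelve. all: by end_near. Qed.

(** The bound on [[0, n]] is applied to a Borel version of [g], and then [n] tends to infinity. *)
Lemma cvg_sub_le_integral_Rplus (F g : R -> R) (l : R) :
  (forall T, 0 <= T -> abs_cont 0 T (F : R -> R^o)) ->
  integrable_Rplus g ->
  ae_Rplus (fun t => derivable F t 1 /\ derive1 F t <= g t) ->
  F t @[t --> +oo] --> l ->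
  l - F 0 <= integral_Rplus g.
Proof.
move=> Fac intg dF Fl.
have mRp : measurable (@Rplus R) by apply: sub_caratheodory; exact: measurable_itv.
(* Extension by zero makes the Borel version integrable on the whole line, where primitives start at
   [-oo]. *)
have mg : measurable_fun [set: LebesgueR R] ((g : LebesgueR R -> R) \_ (@Rplus R)).
  case/integrableP : intg => /measurable_EFinP mg _.
  exact/(measurable_restrictT _ _).1.
have [h mh hg] := borel_version mg.
have hgRp : ae_eq (leb R) (@Rplus R) (fun t => (g t)%:E) (EFin \o h).
  apply/leb_negligibleE; apply: negligibleS hg => t /= /not_implyP[Rt hgt].
  by rewrite patchE mem_set// => hgt'; apply: hgt; rewrite /= hgt'.
have mh' : measurable_fun [set: LebesgueR R] (h : LebesgueR R -> R).
  exact: measurableT_comp mh measurable_fun_leb_id.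
have inth : (leb R).-integrable [set: LebesgueR R] (EFin \o h).
  have [mg0 intg0] := integrableP _ _ _ ((integrable_mkcond _ mRp).1 intg).
  apply/integrableP; split; first exact/measurable_EFinP.
  apply: le_lt_trans intg0; rewrite le_eqVlt; apply/orP; left; apply/eqP.
  apply: ae_eq_integral; [exact: measurableT| | |].
  - by apply/measurable_EFinP; exact: measurableT_comp.
  - exact: measurableT_comp.
  - apply/leb_negligibleE; apply: negligibleS hg => t /= /not_implyP[_ hgt] e.
    by apply: hgt; rewrite e !patchE; case: ifP.
have [inthmu _] := integral_leb_borel measurableT mh inth.
have inthRp : (leb R).-integrable (@Rplus R) (EFin \o h).
  exact: integrableS inth.
have [_ inthE] := integral_leb_borel (measurable_itv `[0%R, +oo[) mh inthRp.
(* The point 0 is null, which reconciles the closed half-line with the intervals []0, n]]. *)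
have -> : integral_Rplus g = \int[mu]_(t in `]0, +oo[) h t.
  rewrite Rintegral_itv_obnd_cbnd//.
    rewrite -inthE /integral_Rplus /Rintegral; congr fine.
    by apply: ae_eq_integral hgRp => //;
      [case/integrableP : intg|case/integrableP : inthRp].
  by apply: integrableS inthmu => //; exact: measurable_itv.
have Fn : F n%:R @[n --> \oo] --> l.
  apply: (cvg_comp _ _ _ Fl); exact: cvgr_idn.
have Fn0 : F n%:R - F 0 @[n --> \oo] --> l - F 0.
  by apply: cvgB => //; exact: cvg_cst.
apply: (ler_cvg_to Fn0 (cvg_integral_itv inthmu)).
near=> n.
have /leb_negligibleE dF' := dF.
apply: (@abs_cont_sub_le_integral F h 0 n%:R (~` [set t | 0 <= t ->
    derivable F t 1 /\ derive1 F t <= g t] `|`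
    [set t | h t <> (g \_ (@Rplus R)) t])) => //.
- exact: Fac.
- exact: negligibleU.
- move=> t /andP[t0 _] /not_orP[/contrapT /(_ t0) [? ?] /contrapT ->].
  by rewrite patchE mem_set//= /Rplus/= in_itv/= t0.
Unshelve. all: by end_near. Qed.

End integral_bound.

(** * Dot products along curves, and supergradients of concave functions *)

Section row_vectors.
Context {R : realType}.

Lemma ler_coord n (v : 'rV[R]_n) (i : 'I_n) : `|v 0 i| <= `|v|.
Proof.
rewrite [leRHS]/Num.norm/= mx_normrE.
exact: (le_bigmax _ (fun ij => `|v ij.1 ij.2|) (0, i)).
Qed.

Lemma dotDl n (u v w : 'rV[R]_n) : dot (u + v) w = dot u w + dot v w.
Proof. by rewrite /dot -big_split; apply: eq_bigr => i _; rewrite mxE mulrDl. Qed.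

Lemma dotC n (v w : 'rV[R]_n) : dot v w = dot w v.
Proof. by apply: eq_bigr => i _; rewrite mulrC. Qed.

Lemma dotNl n (v w : 'rV[R]_n) : dot (- v) w = - dot v w.
Proof. by rewrite /dot -sumrN; apply: eq_bigr => i _; rewrite mxE mulNr. Qed.

Lemma dotZl n (c : R) (v w : 'rV[R]_n) : dot (c *: v) w = c * dot v w.
Proof. by rewrite /dot mulr_sumr; apply: eq_bigr => i _; rewrite mxE mulrA. Qed.

Lemma dotDr n (u v w : 'rV[R]_n) : dot u (v + w) = dot u v + dot u w.
Proof. by rewrite dotC dotDl !(dotC u). Qed.

Lemma dotNr n (v w : 'rV[R]_n) : dot v (- w) = - dot v w.
Proof. by rewrite dotC dotNl dotC. Qed.

Lemma dot_mulmx n (v w : 'rV[R]_n) (A : 'M[R]_n) :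
  dot (v *m A^T) w = dot v (w *m A).
Proof.
have dotE (a b : 'rV[R]_n) : dot a b = (a *m b^T) 0 0.
  by rewrite mxE; apply: eq_bigr => i _; rewrite mxE.
by rewrite !dotE trmx_mul mulmxA.
Qed.

Lemma ler_norm_dot n (v w : 'rV[R]_n) : `|dot v w| <= n%:R * `|v| * `|w|.
Proof.
apply: le_trans (ler_norm_sum _ _ _) _.
apply: (@le_trans _ _ (\sum_(i < n) `|v| * `|w|)).
  by apply: ler_sum => i _; rewrite normrM ler_pM// ler_coord.
by rewrite sumr_const card_ord -mulrA mulr_natl.
Qed.

Lemma is_derive_coord n (V : normedModType R) (f : V -> 'rV[R]_n) (x v : V) df
    (i : 'I_n) :
  is_derive x v f df -> is_derive x v (fun z => f z 0 i) (df 0 i).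
Proof.
move=> [dfx <-]; have /derivable_mxP/(_ 0 i) dfi := dfx.
by apply: DeriveDef => //; rewrite derive_mx// mxE.
Qed.

Lemma is_derive_dot n (V : normedModType R) (f g : V -> 'rV[R]_n) (x v : V) df dg :
  is_derive x v f df -> is_derive x v g dg ->
  is_derive x v (fun z => dot (f z) (g z)) (dot df (g x) + dot (f x) dg).
Proof.
move=> dfx dgx.
have -> : (fun z => dot (f z) (g z)) =
    \sum_(i < n) ((fun z => f z 0 i) * (fun z => g z 0 i)).
  by apply/funext => z; rewrite fct_sumE.
apply: is_derive_eq.
  apply: is_derive_sum => i.
  exact: is_deriveM (is_derive_coord i dfx) (is_derive_coord i dgx).
rewrite big_split/= addrC; congr (_ + _).
by apply: eq_bigr => i _; rewrite /GRing.scale/= mulrC.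
Qed.

(** Over a time step shorter than the [d] belonging to [e = 1] the norm grows by at most 1, and
    finitely many such steps reach [T]. *)
Lemma abs_cont_bounded (V : normedModType R) (T : R) (p : R -> V) : 0 <= T ->
  abs_cont 0 T p -> exists2 C, 0 <= C & forall t, 0 <= t <= T -> `|p t| <= C.
Proof.
move=> T0 /(_ 1 ltr01)[d d0 pd].
have step s t : 0 <= s -> s <= t -> t <= T -> t - s < d -> `|p t| <= `|p s| + 1.
  move=> s0 st tT std.
  have := pd 1%N (fun=> s) (fun=> t).
  rewrite !big_ord1 => /(_ _ _ std) p1.
  have : `|p t - p s| < 1.
    by apply: p1 => // i j _ _ _; rewrite !ord1.
  clear p1 pd; move=> pts.
  have := lerB_dist (p t) (p s); lra.
pose k := (Num.bound (T / d)).+1.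
have kd : T / k%:R < d.
  rewrite ltr_pdivrMr// mulrC -ltr_pdivrMr//.
  apply: lt_trans (archi_boundP _) _; first by rewrite divr_ge0// ltW.
  by rewrite ltr_nat.
exists (`|p 0| + k%:R); first by rewrite addr_ge0.
move=> t /andP[t0 tT].
have bnd i : (i <= k)%N -> `|p (t * (i%:R / k%:R))| <= `|p 0| + i%:R.
  elim: i => [_|i IH ik]; first by rewrite mul0r mulr0 addr0.
  have k0 : 0 < k%:R :> R by rewrite ltr0n.
  have i1 : i.+1%:R / k%:R <= 1 :> R by rewrite ler_pdivrMr// mul1r ler_nat.
  have e1 : t * (i.+1%:R / k%:R) - t * (i%:R / k%:R) = t / k%:R.
    by rewrite -[i.+1]addn1 natrD; field; rewrite gt_eqF.
  have tk : t / k%:R <= T / k%:R by rewrite ler_pM2r// invr_gt0.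
  have tk0 : 0 <= t / k%:R by rewrite divr_ge0.
  have -> : `|p 0| + i.+1%:R = `|p 0| + i%:R + 1 by rewrite -[i.+1]addn1 natrD addrA.
  apply: le_trans (step (t * (i%:R / k%:R)) _ _ _ _ _) _; try lra.
  - by rewrite mulr_ge0// divr_ge0.
  - by apply: le_trans tT; rewrite -[leRHS]mulr1 ler_wpM2l.
  - by have := IH (ltnW ik); lra.
by have := bnd k (leqnn k); rewrite divff ?mulr1// gt_eqF.
Qed.

(** An increment of the product splits into an increment of one factor times a bound on the
    other. *)
Lemma abs_cont_dot n (T C : R) (p d : R -> 'rV[R]_n) : 0 <= T ->
  abs_cont 0 T p -> abs_cont 0 T d -> (forall t, 0 <= t -> `|d t| <= C) ->
  abs_cont 0 T (fun t => dot (p t) (d t) : R^o).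
Proof.
move=> T0 pac dac dC.
have C0 : 0 <= C by apply: le_trans (dC 0 (lexx _)).
have [B B0 pB] := abs_cont_bounded T0 pac.
apply: (@abs_cont_dominated _ _ _ _ _ _ (n%:R * (B + C)) p d) => //.
  by rewrite mulr_ge0// addr_ge0.
move=> s t sT tT.
have -> : dot (p t) (d t) - dot (p s) (d s) =
    dot (p t - p s) (d t) + dot (p s) (d t - d s).
  by rewrite dotDl dotDr dotNl dotNr; lra.
apply: le_trans (ler_normD _ _) _.
have := ler_norm_dot (p t - p s) (d t); have := ler_norm_dot (p s) (d t - d s).
have n0 : 0 <= n%:R :> R by [].
have l1 : n%:R * `|p s| * `|d t - d s| <= n%:R * (B + C) * `|d t - d s|.
  by rewrite ler_wpM2r// ler_wpM2l// (le_trans (pB _ sT))// lerDl.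
have l2 : n%:R * `|p t - p s| * `|d t| <= n%:R * (B + C) * `|p t - p s|.
  rewrite -!mulrA ler_wpM2l// mulrC ler_wpM2r//.
  by case/andP: tT => t0 _; rewrite (le_trans (dC _ t0))// lerDr.
rewrite mulrDr; lra.
Qed.

(* Reflecting [y] across [x] turns concavity into an upper bound of [g y] by a
   difference quotient of [h] at [x]; no finiteness of [g] is needed. *)
Lemma concave_on_le_derive n (g : 'rV[R]_n -> \bar R) (h : 'rV[R]_n -> R)
    (x y : 'rV[R]_n) (gamma a D : R) :
  concave_on [set z | `|z - x| <= gamma] g -> `|y - x| <= gamma ->
  (forall z, (h z)%:E <= g z)%E -> (g x <= (h x)%:E)%E -> (a%:E <= g y)%E ->
  is_derive x (y - x) h D -> a <= h x + D.
Proof.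
move=> cg yx hg gx ay [dh <-].
rewrite -lerBlDl.
(* Left quotients are used because for [t < 0] the point [t *: (y - x) + x] lies opposite to [y]. *)
have cvgh : t^-1 *: (h (t *: (y - x) + x) - h x) @[t --> 0^'-] --> 'D_(y - x) h x.
  apply: cvg_dnbhs_at_left; exact: dh.
rewrite /derive in cvgh *.
apply: (ler_cvg_to (cvg_cst (a - h x)) cvgh).
near=> t.
have t0 : t < 0 by [].
(* This keeps the reflected point in the ball where [g] is concave. *)
have t1 : -1 <= t by near: t; apply: nbhs_left_ge; lra.
pose z := t *: (y - x) + x.
have t10 : 0 < 1 - t by lra.
have zx : `|z - x| <= gamma.
  rewrite /z addrK normrZ ltr0_norm//.
  by apply: (le_trans _ yx); rewrite ler_piMl//; lra.
(* The weight that makes [x] the convex combination of [y] and [z]. *)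
pose b := - t / (1 - t).
have b0 : 0 <= b by rewrite divr_ge0//; lra.
have b1 : b <= 1 by rewrite ler_pdivrMr//; lra.
have b1E : 1 - b = (1 - t)^-1 by rewrite /b; field; rewrite gt_eqF.
have := cg y z b yx zx; rewrite b0 b1 => /(_ isT).
have -> : b *: y + (1 - b) *: z = x.
  by apply/rowP => i; rewrite b1E /z /b !mxE; field; rewrite gt_eqF.
move=> cxz.
have : ((b * a + (1 - b) * h z)%:E <= (h x)%:E)%E.
  apply: (le_trans _ gx); apply: (le_trans _ cxz); rewrite EFinD !EFinM.
  by apply: leeD; apply: lee_wpmul2l; rewrite ?lee_fin ?subr_ge0.
rewrite lee_fin b1E /b => le1.
rewrite /GRing.scale/= -/z.
have : - t * a + h z <= (1 - t) * h x.
  have := ler_wpM2l (ltW t10) le1.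
  rewrite mulrDr !mulrA divff ?gt_eqF// mul1r.
  by rewrite [_ * - t]mulrC mulfK ?gt_eqF.
by move=> le2; rewrite [leRHS]mulrC ler_ndivlMr//; lra.
Unshelve. all: by end_near. Qed.

(** Transversality, coordinate by coordinate: on [I] the factor from [p] vanishes in the limit
    against a bounded one, and off [I] the factor from [d] does. *)
Lemma cvg_dot_bounded n (p d : R -> 'rV[R]_n) (C : R) (I : pred 'I_n) (q : 'rV[R]_n) :
  p t @[t --> +oo] --> q -> (forall i, I i -> q 0 i = 0) ->
  (forall t, 0 <= t -> `|d t| <= C) ->
  (forall i, ~~ I i -> d t 0 i @[t --> +oo] --> 0) ->
  dot (p t) (d t) @[t --> +oo] --> 0.
Proof.
move=> pq q0 dC d0.
have -> : 0 = \sum_(i < n) (0 : R) by rewrite big1.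
apply: (@cvg_big _ _ _ _ _ (@add_continuous R^o)) => i _.
have pi : p t 0 i @[t --> +oo] --> q 0 i.
  exact: (continuous_cvg _ (@coord_continuous R 1 n 0 i q) pq).
have [Ii|nIi] := boolP (I i); last first.
  by rewrite -(mulr0 (q 0 i)); apply: cvgM => //; exact: d0.
rewrite q0// in pi.
have C0 : 0 <= C by apply: le_trans (dC 0 (lexx _)).
apply: norm_cvg0.
apply: (@squeeze_cvgr _ _ _ _ (fun=> 0) (fun t => `|p t 0 i| * C)).
- near=> t; rewrite normr_ge0/= normrM ler_wpM2l//.
  by apply: le_trans (ler_coord _ _) _; apply: dC; near: t; exact: nbhs_pinfty_ge.
- exact: cvg_cst.
- rewrite -(mul0r C); apply: cvgMl; rewrite -(normr0 R).
  exact: cvg_norm.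
Unshelve. all: by end_near. Qed.

End row_vectors.

(** The derivative is written as minus the right-hand side of the adjoint equation, paired with [w],
    to match the derivative of [p] in that of [dot p (y - xs)]. *)
Lemma is_derive_pontryagin (R : realType) (n m : nat) (P : control_problem R n m)
    (t : R) (q x w : 'rV[R]_n) (v : 'rV[R]_m) :
  differentiable (fun z => cost P t z v) x ->
  differentiable (fun z => dynamics P t z v) x ->
  is_derive x w (fun z => pontryagin P t z v q 1)
    (- dot (- (q *m phi_x P t x v) + omega P t *: f_x P t x v) w).
Proof.
move=> df dphi.
have dfw : is_derive x w (fun z => cost P t z v) (dot (f_x P t x v) w).
  apply: DeriveDef; first exact: diff_derivable.
  rewrite deriveE// {1}[w]row_sum_delta linear_sum; apply: eq_bigr => i _.
  by rewrite linearZ /= mxE deriveE// mulrC.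
have dphiw : is_derive x w (fun z => dynamics P t z v)
    (w *m jacobian (fun z => dynamics P t z v) x).
  apply: DeriveDef; first exact: diff_derivable.
  exact: deriveEjacobian.
have dq : is_derive x w (fun=> q) 0 by exact: is_derive_cst.
have -> : (fun z => pontryagin P t z v q 1) =
    (- omega P t) \*: (fun z => cost P t z v) + (fun z => dot q (dynamics P t z v)).
  by apply/funext => z; rewrite /pontryagin mulN1r.
apply: is_derive_eq.
  exact: is_deriveD (is_deriveZ _ dfw) (is_derive_dot dq dphiw).
rewrite dotDl dotNl dotZl /phi_x dot_mulmx /GRing.scale/=.
have -> : dot 0 (dynamics P t x v) = 0.
  by rewrite /dot big1// => i _; rewrite mxE mul0r.
by rewrite opprD opprK add0r mulNr addrC.
Qed.

(** * Comparison with a competing process in the tube of concavity *)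

Theorem theorem5p1 (R : realType) (n m : nat) (P : control_problem R n m)
  (omega_L1 : integrable_Rplus (omega P))
  (omega_pos : 0 < integral_Rplus (fun t => `|omega P t|))
  (U_nonempty : controls P !=set0)
  (xs : R -> 'rV[R]_n) (us : R -> 'rV[R]_m)
  (adm : admissible P xs us) (lip : A_Lip P xs us)
  (p : R -> 'rV[R]_n) (l0 l1 : 'rV[R]_n)
  (p_ac : loc_abs_continuous p)
  (l1_free : forall i : 'I_n, (i < nfree P)%N -> l1 0 i = 0)
  (adjoint : ae_Rplus (fun t => is_derive t 1 p
     (- (p t *m phi_x P t (xs t) (us t))
      + omega P t *: f_x P t (xs t) (us t))))
  (p_initial : p 0 = l0)
  (p_infty : p t @[t --> +oo] --> - l1)
  (maximum : ae_Rplus (fun t =>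
     is_max [set pontryagin P t (xs t) v (p t) 1 | v in controls P]
       (pontryagin P t (xs t) (us t) (p t) 1)))
  (concavity : exists2 gamma : R, 0 < gamma & forall t : R, 0 <= t ->
     concave_on [set y | `|y - xs t| <= gamma]
       (fun y => hamiltonian P t y (p t))) :
  strong_local_minimizer P xs us.
Proof.
split=> //; have [gamma gamma0 conc] := concavity; exists gamma => // y v admy yxs.
have [[xs_ac [Cx xsC] _] [[_ _ usU] [dxs xs0 xs_lim xs_int]]] := adm.
have [[y_ac [Cy yC] _] [[_ _ vU] [dy y0 y_lim y_int]]] := admy.
have [_ [_ [_ lipU]]] := lip.
pose d t := y t - xs t.
have dC t : 0 <= t -> `|d t| <= Cy + Cx.
  by move=> t0; apply: le_trans (ler_normB _ _) _; rewrite lerD ?yC ?xsC.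
have d_ac T : 0 <= T -> abs_cont 0 T d.
  move=> T0; apply: (@abs_cont_dominated _ _ _ _ 0 T 1 y xs) => //.
  - exact: y_ac.
  - exact: xs_ac.
  move=> s t _ _; rewrite mul1r /d.
  rewrite (_ : _ - _ = (y t - y s) - (xs t - xs s)); first exact: ler_normB.
  by rewrite !opprD !opprK addrACA.
pose F t := dot (p t) (d t).
pose g t := cost_integrand P y v t - cost_integrand P xs us t.
have mRp : measurable (@Rplus R) by apply: sub_caratheodory; exact: measurable_itv.
have g_int : integrable_Rplus g.
  by have := integrableB mRp y_int xs_int.
have Jsub : J P y v - J P xs us = integral_Rplus g.
  by rewrite /J /integral_Rplus /g RintegralB.
have F_lim : F t @[t --> +oo] --> 0.
  apply: (cvg_dot_bounded (I := fun i => (i < nfree P)%N) p_infty) dC _.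
    by move=> i ilt; rewrite mxE l1_free// oppr0.
  (* In a coordinate with fixed endpoint both trajectories have the same limit. *)
  move=> i; rewrite -leqNgt => ile.
  rewrite -(subrr (target P 0 i)) /d.
  have -> : (fun t => (y t - xs t) 0 i) = (fun t => y t 0 i - xs t 0 i).
    by apply/funext => t; rewrite !mxE.
  by apply: cvgB; [exact: y_lim|exact: xs_lim].
have dF : ae_Rplus (fun t => derivable F t 1 /\ derive1 F t <= g t).
  have aeF : Filter (almost_everywhere (leb R)) := ae_filter_ringOfSetsType _.
  rewrite /ae_Rplus in adjoint maximum dxs dy *.
  apply: (filterS2 _ _ (filterI adjoint maximum) (filterI dxs dy)).
  move=> t /= [dp maxH] [dxst dyt] t0.
  move: {dp maxH dxst dyt}(dp t0) (maxH t0) (dxst t0) (dyt t0).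
  move=> dp [_ maxH] dxst dyt.
  have dFt := is_derive_dot dp (is_deriveB dyt dxst).
  split; first by case: dFt.
  rewrite derive1E; case: dFt => _ ->.
  (* The compact set is the single control value [us t], which gives differentiability in the state
     at [xs t]. *)
  have [gam gam0 [_ _ diff _ _]] := lipU [set us t] (@compact_set1 _ (us t)).
  have [|//|df dphi] := diff t (xs t) (us t).
    by split => /=; rewrite ?lee_fin// subrr normr0 ltW.
  have H_sup z w : controls P w ->
      ((pontryagin P t z w (p t) 1)%:E <= hamiltonian P t z (p t))%E.
    by move=> Uw; apply: ereal_sup_ubound; exists w.
  (* By the maximum condition the supremum at [xs t] is attained by [us t]; this is the point of
     contact. *)
  have H_max : (hamiltonian P t (xs t) (p t) <=
      (pontryagin P t (xs t) (us t) (p t) 1)%:E)%E.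
    apply: ge_ereal_sup => _ [w Uw <-]; rewrite lee_fin.
    by apply: maxH; exists w.
  (* The supergradient inequality at [xs t], tested with the competitor [(y t, v t)], rearranges to
     the bound of the derivative of [F] by [g]. *)
  have := concave_on_le_derive (conc t t0) (yxs t t0)
    (fun z => H_sup z _ (usU t t0)) H_max (H_sup _ _ (vU t t0))
    (is_derive_pontryagin (p t) (y t - xs t) df dphi).
  rewrite /pontryagin /g /cost_integrand /d !dotDr !dotNr; lra.
have F0 : F 0 = 0.
  rewrite /F /d y0 xs0 subrr dotC /dot big1// => i _.
  by rewrite mxE mul0r.
have F_ac T : 0 <= T -> abs_cont 0 T (F : R -> R^o).
  by move=> T0; exact: abs_cont_dot T0 (p_ac T T0) (d_ac T T0) dC.
have := cvg_sub_le_integral_Rplus F_ac g_int dF F_lim.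
by rewrite -Jsub F0 subr0 subr_ge0.
Qed.
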